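(* Let $G(u)=H(P_\Omega(Q(u)))$ be as described in the context, with Lipschitz constants $c_Q,c_H$, contraction factor $c=c_Hc_Q<1$ on $D$ and fixed point $u^*\in D$, and let $\mathcal{G}(u,\mu)=H(\Phi(Q(u),\mu))$ be the smoothing approximation defined in the context. Then: (i) For any fixed $\mu\in(0,\eta]$, $\mathcal{G}(\cdot,\mu)$ is a contractive mapping on $D$ with contraction factor no larger than $c$. (ii) $\|\mathcal{G}(u,\mu)-G(u)\|\le\kappa\mu$ for all $u\in D$ and $\mu\in(0,\eta]$, with $\kappa=c_H\sqrt l/2$. (iii) $\mathcal{G}(u^*,\mu)=G(u^* )=u^*$ for all $\mu\in(0,\bar\mu]$. Here $\eta$ and $\bar\mu$ are the parameters defined in the context.
   Context: $\|\cdot\|$ is the Euclidean norm; $\mathcal{B}(r,x)=\{y:\|y-x\|\le r\}$. $\Omega=\{w\in\mathbb{R}^l:\underline w\le w\le\overline w\}$ with $\underline w\in(\{-\infty\}\cup\mathbb{R})^l$, $\overline w\in(\mathbb{R}\cup\{\infty\})^l$, $\underline w<\overline w$ componentwise, and $P_\Omega$ is the Euclidean projection onto $\Omega$. $Q:\mathbb{R}^n\to\mathbb{R}^l$, $H:\mathbb{R}^l\to\mathbb{R}^n$, $G(u):=H(P_\Omega(Q(u)))$. $D\subset\mathbb{R}^n$ is a closed set with $G(D)\subseteq D$. Standing assumptions: (a) $Q$ is continuously differentiable on $D$ with Lipschitz continuous derivative, and is Lipschitz continuous on $D$ with constant $c_Q$; (b) $H$ is continuously differentiable with Lipschitz continuous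 derivative on an open set $D_H\supseteq\Omega$, and is Lipschitz continuous on $D_H$ with constant $c_H$; (c) $c:=c_Hc_Q<1$. Thus $G$ is a contraction on $D$ with factor $c$ and has a unique fixed point $u^*\in D$; it is assumed that some ball $\mathcal{B}(\delta,u^* )$, $\delta>0$, is contained in $D$. For $\mu\in(0,1]$ define $$\psi(t,\mu)=\begin{cases}0,& t\le0,\\ \frac{t^2}{2\mu},&0<t\le\mu,\\ \frac14(t-\mu)^2+t-\frac12\mu,&\mu<t\le\mu+\sqrt\mu,\\ -\frac14(t-\mu-2\sqrt\mu)^2+t,&\mu+\sqrt\mu<t\le\mu+2\sqrt\mu,\\ t,&t>\mu+2\sqrt\mu,\end{cases}$$ and $\Phi(v,\mu)=(\phi_1(v_1,\mu),\ldots,\phi_l(v_l,\mu))^{\rm T}$ with $\phi_i(t,\mu)=\psi(\underline w_i-t,\mu)+t-\psi(t-\overline w_i,\mu)$, where a $\psi$-term whose argument is $-\infty$ (infinite bound) is $0$. Parameters: $\eta\in(0,1]$ is a number such that $\Omega+\mathcal{B}(\sqrt l\,\eta/2,\mathbf{0})\subseteq D_H$ (assumed to exist). $\varpi_1$ is the minimum of $3$ and all numbers $\underline w_i-Q_i(u^* )$ over indices $i$ with $Q_i(u^* )<\underline w_i$; $\varpi_2$ is the minimum of $3$ and all numbers $Q_i(u^* )-\overline w_i$ over indices $i$ with $Q_i(u^* )>\overline w_i$. $\bar\mu:=\min\{\eta,(\varpi_1/3)^2,(\varpi_2/3)^2\}$. *)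

(* Defs.v *)
From HB Require Import structures.
From mathcomp Require Import all_boot all_order all_algebra.
From mathcomp Require Import all_classical all_reals all_analysis.

Set Implicit Arguments.
Unset Strict Implicit.
Unset Printing Implicit Defensive.

Import Order.TTheory GRing.Theory Num.Theory.
Import numFieldNormedType.Exports.

Local Open Scope classical_set_scope.
Local Open Scope ring_scope.

(* Points of R^n are row vectors. The canonical norm `|x| on 'rV[R]_n is the
   max norm; it is used only through the topology and differentiability, which
   do not depend on the norm. All quantitative statements use [enorm]. *)
Definition enorm (R : realType) (n : nat) (x : 'rV[R]_n) : R :=
  Num.sqrt (\sum_(i < n) x 0 i ^+ 2).

Definition eball (R : realType) (n : nat) (r : R) (x : 'rV[R]_n) : set 'rV[R]_n :=
  [set y | enorm (y - x) <= r].

Definition elipschitz (R : realType) (m n : nat) (k : R) (A : set 'rV[R]_m)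
    (f : 'rV[R]_m -> 'rV[R]_n) : Prop :=
  0 <= k /\
  forall x y, A x -> A y -> enorm (f x - f y) <= k * enorm (x - y).

(* Contractivity is the metric condition only: [f] need not map [A] to [A]. *)
Definition econtraction (R : realType) (n : nat) (q : R) (A : set 'rV[R]_n)
    (f : 'rV[R]_n -> 'rV[R]_n) : Prop :=
  q < 1 /\ elipschitz q A f.

(* The last clause says that the Euclidean operator norm of the difference of
   the derivatives at x and y is at most L * enorm (x - y). *)
Definition C1_lipschitz_derivative (R : realType) (m n : nat)
    (A : set 'rV[R]_m) (f : 'rV[R]_m -> 'rV[R]_n) : Prop :=
  [/\ forall x, A x -> differentiable f x,
      {within A, continuous (jacobian f)} &
      exists2 L : R, 0 <= L & forall x y v, A x -> A y ->
        enorm ('d f x v - 'd f y v) <= L * enorm (x - y) * enorm v].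

Definition box (R : realType) (l : nat) (lo hi : 'I_l -> \bar R) :
    set 'rV[R]_l :=
  [set w | forall i, (lo i <= (w 0 i)%:E)%E /\ ((w 0 i)%:E <= hi i)%E].

(* Total by convention: 0 when no nearest point exists. *)
Definition eproj (R : realType) (n : nat) (A : set 'rV[R]_n) (x : 'rV[R]_n) :
    'rV[R]_n :=
  xget 0 [set p | A p /\ forall y, A y -> enorm (x - p) <= enorm (x - y)].

Definition psi (R : realType) (t mu : R) : R :=
  if t <= 0 then 0
  else if t <= mu then t ^+ 2 / (2 * mu)
  else if t <= mu + Num.sqrt mu then
    (t - mu) ^+ 2 / 4 + t - mu / 2
  else if t <= mu + 2 * Num.sqrt mu then
    - ((t - mu - 2 * Num.sqrt mu) ^+ 2 / 4) + t
  else t.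

(* A term with argument -oo vanishes; the argument +oo never arises, since
   lower bounds are < +oo and upper bounds are > -oo. *)
Definition psi_ext (R : realType) (x : \bar R) (mu : R) : R :=
  if x is t%:E then psi t mu else 0.

Definition phi (R : realType) (a b : \bar R) (t mu : R) : R :=
  psi_ext (a - t%:E)%E mu + t - psi_ext (t%:E - b)%E mu.

Definition Phi (R : realType) (l : nat) (lo hi : 'I_l -> \bar R)
    (v : 'rV[R]_l) (mu : R) : 'rV[R]_l :=
  \row_i phi (lo i) (hi i) (v 0 i) mu.

Definition Gmap (R : realType) (n l : nat) (lo hi : 'I_l -> \bar R)
    (Q : 'rV[R]_n -> 'rV[R]_l) (H : 'rV[R]_l -> 'rV[R]_n) (u : 'rV[R]_n) :
    'rV[R]_n :=
  H (eproj (box lo hi) (Q u)).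

Definition Gsmooth (R : realType) (n l : nat) (lo hi : 'I_l -> \bar R)
    (Q : 'rV[R]_n -> 'rV[R]_l) (H : 'rV[R]_l -> 'rV[R]_n)
    (u : 'rV[R]_n) (mu : R) : 'rV[R]_n :=
  H (Phi lo hi (Q u) mu).

(* In [varpi1] and [varpi2], [q] stands for Q(u^* ), and the bounds selected by
   the index conditions are finite, so [fine] loses nothing. *)
Definition varpi1 (R : realType) (l : nat) (lo : 'I_l -> \bar R)
    (q : 'rV[R]_l) : R :=
  \big[Num.min/3]_(i < l | ((q 0 i)%:E < lo i)%E) (fine (lo i) - q 0 i).

Definition varpi2 (R : realType) (l : nat) (hi : 'I_l -> \bar R)
    (q : 'rV[R]_l) : R :=
  \big[Num.min/3]_(i < l | (hi i < (q 0 i)%:E)%E) (q 0 i - fine (hi i)).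

Definition mubar (R : realType) (l : nat) (lo hi : 'I_l -> \bar R)
    (q : 'rV[R]_l) (eta : R) : R :=
  Num.min eta (Num.min ((varpi1 lo q / 3) ^+ 2) ((varpi2 hi q / 3) ^+ 2)).

(* Main.v *)
Require Import Defs.
From HB Require Import structures.
From mathcomp Require Import all_boot all_order all_algebra.
From mathcomp Require Import ring lra.
From mathcomp Require Import all_classical all_reals all_analysis.

(** The map [Phi] is a smoothing of the projection onto the box, and everything
    rests on comparing the two one coordinate at a time.

    In one coordinate the projection is [clamp a b t], which is
    (a - t)^+ + t - (t - b)^+, and [phi] is the same formula with each positive
    part replaced by [psi]. Two facts about [psi] suffice. Its slope lies
    between 0 and 2 on the positive axis and it vanishes on the negative axis
    ([psi_increment]); since a < b, the two [psi]-terms never vary at the same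
    point, so [phi] has slope 1 - psi' in [-1, 1] and is nonexpansive
    ([phi_nonexpansive]). And [psi] differs from the positive part by at most
    mu / 2 ([psi_error]), with equality of the two once the argument exceeds
    mu + 2 sqrt mu ([psi_id]).

    Summing squares, [Phi] is nonexpansive for the Euclidean norm and lies
    within sqrt l * mu / 2 of the projection ([phi_clamp_error],
    [eproj_clamp]). The second bound is what places the values of [Phi] in the
    set where [H] is Lipschitz, so composing with [H] and [Q] yields the
    contraction factor cH cQ and the error cH sqrt l mu / 2. At the fixed
    point, mu <= (varpi / 3)^2 and mu <= 1 give mu + 2 sqrt mu <= 3 sqrt mu <=
    varpi, so every coordinate of Q(u^* ) outside the box is far enough out for
    [phi] to coincide with [clamp] ([phi_eq_clamp]). *)

Set Implicit Arguments.
Unset Strict Implicit.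
Unset Printing Implicit Defensive.

Import Order.TTheory GRing.Theory Num.Theory.
Import numFieldNormedType.Exports.

Local Open Scope classical_set_scope.
Local Open Scope ring_scope.

(** * The scalar smoothing function *)

Lemma psi_neg (R : realType) (t mu : R) : t <= 0 -> psi t mu = 0.
Proof. by rewrite /psi => ->. Qed.

(** The quadratic and linear branch formulas of [psi] also hold at the left ends
    of their intervals, because the branches agree there. Having both ends
    available lets increments be chained across the break points. *)
Lemma psi_quad (R : realType) (t mu : R) :
  0 <= t <= mu -> psi t mu = t ^+ 2 / (2 * mu).
Proof.
move=> /andP[t0 tmu]; rewrite /psi tmu; case: leP => // t0'.
have -> : t = 0 by lra.
by rewrite expr0n mul0r.
Qed.

Lemma psi_up (R : realType) (t mu : R) : 0 < mu ->
  mu <= t <= mu + Num.sqrt mu -> psi t mu = (t - mu) ^+ 2 / 4 + t - mu / 2.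
Proof.
move=> mu0 /andP[mut ht]; rewrite /psi ht; case: leP => [|_]; first lra.
case: leP => // tmu; have -> : t = mu by lra.
by field; rewrite gt_eqF.
Qed.

Lemma psi_down (R : realType) (t mu : R) : 0 < mu ->
  mu + Num.sqrt mu <= t <= mu + 2 * Num.sqrt mu ->
  psi t mu = - ((t - mu - 2 * Num.sqrt mu) ^+ 2 / 4) + t.
Proof.
move=> mu0 /andP[h1 ht]; have r0 : 0 < Num.sqrt mu by rewrite sqrtr_gt0.
case: (leP t (mu + Num.sqrt mu)) => h2.
  rewrite psi_up//; last by apply/andP; split; lra.
  have rr : Num.sqrt mu ^+ 2 = mu by rewrite sqr_sqrtr// ltW.
  have -> : t = mu + Num.sqrt mu by lra.
  by move: rr; set r := Num.sqrt mu => <-; field.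
by rewrite /psi ht; do 3 (case: leP => [?|_]; first lra).
Qed.

Lemma psi_id (R : realType) (t mu : R) : 0 < mu ->
  mu + 2 * Num.sqrt mu <= t -> psi t mu = t.
Proof.
move=> mu0 h; have r0 : 0 < Num.sqrt mu by rewrite sqrtr_gt0.
case: (leP t (mu + 2 * Num.sqrt mu)) => h2.
  have -> : t = mu + 2 * Num.sqrt mu by lra.
  by rewrite psi_down//; [field | apply/andP; split; lra].
by rewrite /psi; do 4 (case: leP => [?|_]; first lra).
Qed.

(** The slope reaches 1 + sqrt mu / 2 at mu + sqrt mu, which is at most 2 because
    mu <= 1. Measuring the increment against that of the positive part, rather
    than against t - s, keeps track of the vanishing on the negative axis; this
    is what allows the two [psi]-terms of [phi] to be added without doubling
    the bound. *)
Lemma psi_increment (R : realType) (mu s t : R) : 0 < mu <= 1 -> s <= t ->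
  0 <= psi t mu - psi s mu <= 2 * (Num.max t 0 - Num.max s 0).
Proof.
move=> /andP[mu0 mu1].
pose I s t := 0 <= psi t mu - psi s mu <= 2 * (Num.max t 0 - Num.max s 0).
(* The bound is additive over adjacent intervals, so it is enough to check it on
   each piece of [psi]. *)
have glue (m m' : R) : (forall x y, x <= y -> y <= m -> I x y) ->
    (forall x y, m <= x -> x <= y -> y <= m' -> I x y) ->
    forall x y, x <= y -> y <= m' -> I x y.
  move=> Il Ir x y xy ym'; case: (leP y m) => ym; first exact: Il.
  case: (leP m x) => mx; first exact: Ir.
  have /andP[? ?] := Il _ _ (ltW mx) (lexx m).
  have /andP[? ?] := Ir _ _ (lexx m) (ltW ym) ym'.
  by apply/andP; split; lra.
have r0 : 0 < Num.sqrt mu by rewrite sqrtr_gt0.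
have r1 : Num.sqrt mu <= 1 by rewrite -sqrtr1 ler_sqrt.
(* On each quadratic piece the difference quotient [h] is an explicit affine
   function of [x + y]. *)
have slope (x y h : R) : 0 <= x -> x <= y -> 0 <= h <= 2 ->
    psi y mu - psi x mu = (y - x) * h -> I x y.
  move=> x0 xy /andP[h0 h2] e.
  rewrite /I e !max_l//; last exact: le_trans xy.
  by rewrite mulr_ge0 ?subr_ge0//= mulrC ler_wpM2r ?subr_ge0.
move=> st; move: (lexx t); move: s t st.
(* The last piece is unbounded; cutting it at [t] gives it the form [glue]
   expects. *)
suff H t : forall x y, x <= y -> y <= t -> I x y.
  by move=> s t st _; exact: H st (lexx t).
apply: (glue (mu + 2 * Num.sqrt mu)); first apply: (glue (mu + Num.sqrt mu));
  first apply: (glue mu); first apply: (glue 0).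
- move=> x y xy y0; have x0 := le_trans xy y0.
  by rewrite /I !psi_neg// !max_r// !subrr mulr0 lexx.
- move=> x y x0 xy ymu; apply: (slope _ _ ((x + y) / (2 * mu))) => //.
    have mu2 : 0 < 2 * mu by rewrite mulr_gt0.
    by apply/andP; split; [rewrite divr_ge0; lra | rewrite ler_pdivrMr//; lra].
  rewrite !psi_quad; try (by apply/andP; split; lra).
  by field; rewrite gt_eqF.
- move=> x y x0 xy ymu; apply: (slope _ _ (1 + (x + y - 2 * mu) / 4)); try lra.
  rewrite !psi_up//; try (by apply/andP; split; lra).
  by field.
- move=> x y x0 xy ymu.
  apply: (slope _ _ (1 + (2 * mu + 4 * Num.sqrt mu - x - y) / 4)); try lra.
  rewrite !psi_down//; try (by apply/andP; split; lra).
  by field.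
- move=> x y x0 xy _; apply: (slope _ _ 1); try lra.
  by rewrite !psi_id ?mulr1//; lra.
Qed.

(** Over (0, mu] the deviation from t is (mu - t)^2 / (2 mu) - mu / 2; on the two
    later pieces it is a square of at most sqrt mu, divided by 4, shifted by
    -mu / 2 or with the opposite sign. *)
Lemma psi_error (R : realType) (mu t : R) : 0 < mu ->
  `|psi t mu - Num.max t 0| <= mu / 2.
Proof.
move=> mu0; have r0 : 0 < Num.sqrt mu by rewrite sqrtr_gt0.
have rr : Num.sqrt mu ^+ 2 = mu by rewrite sqr_sqrtr// ltW.
case: (leP t 0) => t0.
  by rewrite psi_neg// subrr normr0 divr_ge0// ltW.
rewrite ler_norml.
case: (leP t mu) => t1.
  rewrite psi_quad ?(ltW t0)//.
  have -> : t ^+ 2 / (2 * mu) - t = (mu - t) ^+ 2 / (2 * mu) - mu / 2.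
    by field; rewrite gt_eqF.
  have : 0 <= (mu - t) ^+ 2 / (2 * mu) <= mu / 2.
    have mu2 : 0 < 2 * mu by rewrite mulr_gt0.
    apply/andP; split; first by rewrite divr_ge0 ?sqr_ge0 ?ltW.
    rewrite ler_pdivrMr//; nra.
  by move=> /andP[? ?]; apply/andP; split; lra.
case: (leP t (mu + Num.sqrt mu)) => t2.
  rewrite psi_up//; last by rewrite (ltW t1).
  by apply/andP; split; nra.
case: (leP t (mu + 2 * Num.sqrt mu)) => t3.
  rewrite psi_down//; last by rewrite (ltW t2).
  by apply/andP; split; nra.
by rewrite psi_id ?(ltW t3)//; apply/andP; split; lra.
Qed.

(** * The scalar smoothing of the projection onto an interval *)

(** The counterpart of [psi_ext] for the positive part: an argument -oo, coming
    from an infinite bound, contributes 0. *)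
Definition pos_ext (R : realType) (x : \bar R) : R :=
  if x is t%:E then Num.max t 0 else 0.

(** The projection onto the interval [a, b], written so that it differs from [phi]
    only by having positive parts in place of [psi]. *)
Definition clamp (R : realType) (a b : \bar R) (t : R) : R :=
  pos_ext (a - t%:E)%E + t - pos_ext (t%:E - b)%E.

Lemma clamp_bounded (R : realType) (a b : \bar R) (t : R) :
  (a < +oo)%E -> (-oo < b)%E -> (a < b)%E ->
  (a <= (clamp a b t)%:E)%E /\ ((clamp a b t)%:E <= b)%E.
Proof.
rewrite /clamp; case: a => [a| |] //; case: b => [b| |] // _ _;
  rewrite /= ?leey ?leNye ?lte_fin ?lee_fin => ab; split=> //;
  try (case: (leP (a - t) 0) => ?); try (case: (leP (t - b) 0) => ?); lra.
Qed.

(** The variational inequality characterizing the projection onto a convex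
    set. *)
Lemma clamp_obtuse (R : realType) (a b : \bar R) (t y : R) :
  (a < +oo)%E -> (-oo < b)%E -> (a < b)%E ->
  (a <= y%:E)%E -> (y%:E <= b)%E ->
  (t - clamp a b t) * (y - clamp a b t) <= 0.
Proof.
rewrite /clamp; case: a => [a| |] //; case: b => [b| |] // _ _;
  rewrite /= ?lte_fin ?lee_fin => ab ay yb;
  try (case: (leP (a - t) 0) => ?); try (case: (leP (t - b) 0) => ?); nra.
Qed.

(** For s <= t, the two [psi]-increments are nonnegative and their sum is at most
    twice the sum of the increments of the positive parts. The latter sum is
    (t - s) - (clamp t - clamp s) <= t - s, so the increment of [phi] is t - s
    minus something in [0, 2 (t - s)]. *)
Lemma phi_nonexpansive (R : realType) (a b : \bar R) (mu s t : R) :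
  (a < +oo)%E -> (-oo < b)%E -> (a < b)%E -> 0 < mu <= 1 ->
  `|phi a b s mu - phi a b t mu| <= `|s - t|.
Proof.
move=> aoo boo ab mu01.
wlog st : s t / s <= t.
  move=> H; case: (leP s t) => [|/ltW] ?; first exact: H.
  by rewrite distrC (distrC s); exact: H.
rewrite (distrC s) (distrC (phi _ _ _ _)) (ger0_norm (_ : 0 <= t - s)) ?subr_ge0//.
rewrite ler_norml /phi.
case: a aoo ab => [a| |] // _; case: b boo => [b| |] // _ //=;
  rewrite ?lte_fin => ab.
- have /(psi_increment mu01)/andP[] : a - t <= a - s by lra.
  have /(psi_increment mu01)/andP[] : s - b <= t - b by lra.
  case: (leP (a - t) 0); case: (leP (a - s) 0); case: (leP (s - b) 0);
    case: (leP (t - b) 0); move=> *; apply/andP; split; lra.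
- have /(psi_increment mu01)/andP[] : a - t <= a - s by lra.
  case: (leP (a - t) 0); case: (leP (a - s) 0); move=> *; apply/andP; split; lra.
- have /(psi_increment mu01)/andP[] : s - b <= t - b by lra.
  case: (leP (s - b) 0); case: (leP (t - b) 0); move=> *; apply/andP; split; lra.
- by apply/andP; split; lra.
Qed.

(** Since a < b, at most one of a - t and t - b is positive, so only one of the
    two errors of size mu / 2 is present. *)
Lemma phi_clamp_error (R : realType) (a b : \bar R) (mu t : R) :
  (a < +oo)%E -> (-oo < b)%E -> (a < b)%E -> 0 < mu ->
  `|phi a b t mu - clamp a b t| <= mu / 2.
Proof.
move=> aoo boo ab mu0; rewrite /phi /clamp.
have upper_only (x : R) : 0 + t - psi x mu - (0 + t - Num.max x 0) =
    - (psi x mu - Num.max x 0) by ring.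
have lower_only (x : R) : psi x mu + t - 0 - (Num.max x 0 + t - 0) =
    psi x mu - Num.max x 0 by ring.
have lower (x y : R) : y <= 0 -> psi x mu + t - psi y mu -
    (Num.max x 0 + t - Num.max y 0) = psi x mu - Num.max x 0.
  by move=> y0; rewrite (psi_neg _ y0) (max_r y0); ring.
case: a aoo ab => [a| |] // _; case: b boo => [b| |] // _ //=;
  rewrite ?lte_fin => ab.
- case: (leP t b) => tb; first by rewrite lower ?psi_error ?subr_le0.
  have at0 : a - t <= 0 by lra.
  by rewrite (psi_neg _ at0) (max_r at0) upper_only normrN psi_error.
- by rewrite lower_only psi_error.
- by rewrite upper_only normrN psi_error.
- by rewrite !subrr normr0 divr_ge0// ltW.
Qed.

Lemma phi_eq_clamp (R : realType) (a b : \bar R) (mu t : R) : 0 < mu ->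
  (a < +oo)%E -> (-oo < b)%E ->
  ((t%:E < a)%E -> mu + 2 * Num.sqrt mu <= fine a - t) ->
  ((b < t%:E)%E -> mu + 2 * Num.sqrt mu <= t - fine b) ->
  phi a b t mu = clamp a b t.
Proof.
move=> mu0 aoo boo ha hb; rewrite /phi /clamp.
have E (x : R) : (0 < x -> mu + 2 * Num.sqrt mu <= x) ->
    psi x mu = Num.max x 0.
  by case: leP => [x0 _|x0 hx]; [rewrite psi_neg | rewrite psi_id// hx].
congr (_ + _ - _).
  case: a aoo ha => [a| |] //= _; rewrite lte_fin => ha.
  by apply: E; rewrite subr_gt0.
case: b boo hb => [b| |] //= _; rewrite lte_fin => hb.
by apply: E; rewrite subr_gt0.
Qed.

(** * Euclidean norm and projection onto the box *)

Lemma enorm_le (R : realType) (n : nat) (x y : 'rV[R]_n) :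
  (forall i, `|x 0 i| <= `|y 0 i|) -> enorm x <= enorm y.
Proof.
move=> xy; rewrite /enorm ler_sqrt; last by apply: sumr_ge0 => i _; exact: sqr_ge0.
apply: ler_sum => i _; rewrite -(real_normK (num_real (x 0 i))).
by rewrite -(real_normK (num_real (y 0 i))) lerXn2r ?nnegrE.
Qed.

Lemma enorm_le_const (R : realType) (n : nat) (x : 'rV[R]_n) (e : R) :
  (forall i, `|x 0 i| <= e) -> enorm x <= Num.sqrt n%:R * `|e|.
Proof.
move=> xe.
have -> : Num.sqrt n%:R * `|e| = enorm (const_mx e : 'rV[R]_n).
  rewrite /enorm (eq_bigr (fun=> e ^+ 2)); last by move=> i _; rewrite mxE.
  by rewrite sumr_const card_ord -(mulr_natl (e ^+ 2)) sqrtrM ?ler0n// sqrtr_sqr.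
by apply: enorm_le => i; rewrite mxE (le_trans (xe i))// ler_norm.
Qed.

(** Adding the coordinatewise obtuse angle inequalities gives
    |x - c|^2 + |y - c|^2 <= |x - y|^2 for every y in the box, where c is the
    clamped vector: c is a nearest point, and any other nearest point p
    satisfies |p - c|^2 <= 0. *)
Lemma eproj_clamp (R : realType) (l : nat) (lo hi : 'I_l -> \bar R)
    (x : 'rV[R]_l) :
  (forall i, (lo i < +oo)%E) -> (forall i, (-oo < hi i)%E) ->
  (forall i, (lo i < hi i)%E) ->
  eproj (box lo hi) x = \row_i clamp (lo i) (hi i) (x 0 i).
Proof.
move=> looo hioo lohi; set c := \row_i _.
have c_box : box lo hi c by move=> i; rewrite mxE; exact: clamp_bounded.
have pythagoras y : box lo hi y -> forall i,
    (x 0 i - c 0 i) ^+ 2 + (y 0 i - c 0 i) ^+ 2 <= (x 0 i - y 0 i) ^+ 2.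
  move=> yb i; have [ly yh] := yb i.
  have := clamp_obtuse (x 0 i) (looo i) (hioo i) (lohi i) ly yh.
  by rewrite !mxE; nra.
apply: xget_unique.
- split=> // y yb; apply: enorm_le => i; rewrite !mxE.
  have := pythagoras y yb i; rewrite !mxE => h.
  rewrite -ler_sqr ?nnegrE// !real_normK ?num_real//.
  by apply: le_trans h; rewrite lerDl sqr_ge0.
- move=> p [pb /(_ c c_box)]; rewrite /enorm ler_sqrt; last first.
    by apply: sumr_ge0 => i _; exact: sqr_ge0.
  have sub (u v : 'rV[R]_l) i : (u - v) 0 i = u 0 i - v 0 i by rewrite !mxE.
  under eq_bigr do rewrite sub; under [X in _ <= X]eq_bigr do rewrite sub.
  move=> pc; have : \sum_i (p 0 i - c 0 i) ^+ 2 <= 0.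
    rewrite -(lerD2l (\sum_i (x 0 i - c 0 i) ^+ 2)) addr0 -big_split/=.
    apply: le_trans pc.
    by apply: ler_sum => i _; exact: pythagoras.
  move=> s0; have /eqP : \sum_i (p 0 i - c 0 i) ^+ 2 = 0.
    by apply/le_anti; rewrite s0 sumr_ge0// => i _; exact: sqr_ge0.
  rewrite psumr_eq0; last by move=> i _; exact: sqr_ge0.
  move=> /allP s0'; apply/rowP => i; apply/eqP.
  by have := s0' i (mem_index_enum i); rewrite sqrf_eq0 subr_eq0.
Qed.

(** * The smoothed fixed point map *)

Theorem theorem3p5 (R : realType) (n l : nat)
    (lo hi : 'I_l -> \bar R)
    (Q : 'rV[R]_n -> 'rV[R]_l) (H : 'rV[R]_l -> 'rV[R]_n)
    (D : set 'rV[R]_n) (DH : set 'rV[R]_l)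
    (cQ cH : R) (ustar : 'rV[R]_n) (delta eta : R)
    (lo_lt_pinfty : forall i, (lo i < +oo)%E)
    (hi_gt_ninfty : forall i, (-oo < hi i)%E)
    (lo_lt_hi : forall i, (lo i < hi i)%E)
    (D_closed : closed D)
    (G_maps_D : forall u, D u -> D (Gmap lo hi Q H u))
    (Q_C1 : C1_lipschitz_derivative D Q)
    (Q_lip : elipschitz cQ D Q)
    (DH_open : open DH)
    (box_DH : box lo hi `<=` DH)
    (H_C1 : C1_lipschitz_derivative DH H)
    (H_lip : elipschitz cH DH H)
    (c_lt1 : cH * cQ < 1)
    (ustar_D : D ustar)
    (ustar_fix : Gmap lo hi Q H ustar = ustar)
    (delta_gt0 : 0 < delta)
    (ball_D : eball delta ustar `<=` D)
    (eta_gt0 : 0 < eta) (eta_le1 : eta <= 1)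
    (eta_DH : [set w + z | w in box lo hi &
                 z in eball (Num.sqrt l%:R * eta / 2) (0 : 'rV[R]_l)] `<=` DH) :
  [/\ (forall mu : R, 0 < mu <= eta ->
         exists2 q : R, q <= cH * cQ &
           econtraction q D (fun u => Gsmooth lo hi Q H u mu)),
      (forall (u : 'rV[R]_n) (mu : R), D u -> 0 < mu <= eta ->
         enorm (Gsmooth lo hi Q H u mu - Gmap lo hi Q H u)
           <= cH * Num.sqrt l%:R / 2 * mu) &
      (forall mu : R, 0 < mu <= mubar lo hi (Q ustar) eta ->
         Gsmooth lo hi Q H ustar mu = Gmap lo hi Q H ustar /\
         Gmap lo hi Q H ustar = ustar)].
Proof.
have [cQ0 Qlip] := Q_lip; have [cH0 Hlip] := H_lip.
have c0 : 0 <= cH * cQ by rewrite mulr_ge0.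
have projE x := eproj_clamp x lo_lt_pinfty hi_gt_ninfty lo_lt_hi.
have proj_box x : box lo hi (eproj (box lo hi) x).
  by rewrite projE => i; rewrite mxE; exact: clamp_bounded.
have Phi_error x mu : 0 < mu ->
    enorm (Phi lo hi x mu - eproj (box lo hi) x) <= Num.sqrt l%:R * mu / 2.
  move=> mu0; rewrite projE -mulrA -[mu / 2]ger0_norm ?divr_ge0 ?(ltW mu0)//.
  by apply: enorm_le_const => i; rewrite !mxE; exact: phi_clamp_error.
(* [Phi] is a point of the box plus a vector of norm at most sqrt l * eta / 2. *)
have Phi_DH x mu : 0 < mu <= eta -> DH (Phi lo hi x mu).
  move=> /andP[mu0 mueta]; apply: eta_DH.
  exists (eproj (box lo hi) x); first exact: proj_box.
  exists (Phi lo hi x mu - eproj (box lo hi) x); last by rewrite addrC subrK.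
  rewrite /eball /= subr0 (le_trans (Phi_error _ _ mu0))//.
  by rewrite ler_wpM2r// ler_wpM2l// sqrtr_ge0.
split.
- move=> mu mu_eta; exists (cH * cQ) => //; split=> //; split=> // x y Dx Dy.
  have mu01 : 0 < mu <= 1.
    by case/andP: mu_eta => -> /le_trans ->.
  apply: le_trans (Hlip _ _ (Phi_DH _ _ mu_eta) (Phi_DH _ _ mu_eta)) _.
  rewrite -mulrA ler_wpM2l//; apply: le_trans (Qlip _ _ Dx Dy).
  by apply: enorm_le => i; rewrite !mxE; exact: phi_nonexpansive.
- move=> u mu Du mu_eta; have /andP[mu0 _] := mu_eta.
  apply: le_trans (Hlip _ _ (Phi_DH _ _ mu_eta) (box_DH _ (proj_box _))) _.
  have -> : cH * Num.sqrt l%:R / 2 * mu = cH * (Num.sqrt l%:R * mu / 2) by ring.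
  by rewrite ler_wpM2l// Phi_error.
- move=> mu /andP[mu0]; rewrite /mubar !le_min => /andP[mu_eta /andP[mu1 mu2]].
  split=> //; congr H; rewrite projE; apply/rowP => i; rewrite !mxE.
  have mule1 : mu <= 1 by exact: le_trans eta_le1.
  have r0 : 0 < Num.sqrt mu by rewrite sqrtr_gt0.
  have sqr_mu : Num.sqrt mu ^+ 2 = mu by rewrite sqr_sqrtr// ltW.
  have bound (v : R) : 0 <= v -> mu <= (v / 3) ^+ 2 ->
      mu + 2 * Num.sqrt mu <= v.
    move=> v0 hv; have : Num.sqrt mu <= v / 3.
      by rewrite -ler_sqr ?nnegrE ?sqr_mu ?divr_ge0 ?(ltW r0).
    have : Num.sqrt mu <= 1 by rewrite -sqrtr1 ler_sqrt.
    nra.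
  apply: phi_eq_clamp => // [lt_lo|gt_hi].
  + apply: le_trans (bound _ _ mu1) _; last exact: bigmin_le_cond.
    apply/bigmin_geP; split=> // j; move: (lo j) (lo_lt_pinfty j) => [r| |]//= _.
    by rewrite lte_fin subr_ge0 => /ltW.
  + apply: le_trans (bound _ _ mu2) _; last exact: bigmin_le_cond.
    apply/bigmin_geP; split=> // j; move: (hi j) (hi_gt_ninfty j) => [r| |]//= _.
    by rewrite lte_fin subr_ge0 => /ltW.
Qed.
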